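(* For every $t\ge0$, $$\mathcal C_{26\cdot2^t-4}(4)=0.$$ Equivalently, the restriction map $$\rho_{26\cdot2^t-4}:K_{26\cdot2^t-4}(4)\longrightarrow K^\Sigma_{26\cdot2^t-4}(4)$$ is surjective for every $t\ge 0$.
   Context: $P(4)=\mathbf F_2[x_1,\dots,x_4]$, $|x_i|=1$; the total Steenrod square $\mathrm{Sq}=\sum_r\mathrm{Sq}^r$ is the algebra endomorphism with $\mathrm{Sq}(x_i)=x_i+x_i^2$. $\Sigma_4$ permutes the variables and $B(4)=P(4)^{\Sigma_4}$. For $M=P(4)$ or $B(4)$, $\mathcal H^d(M)=\sum_{r>0}\mathrm{Sq}^r(M^{d-r})$ and $Q_d(M)=M^d/\mathcal H^d(M)$. The relative cohit space is $\mathcal C_d(4)=\ker\big(Q_d(B(4))\to Q_d(P(4))\big)=\big(B^d(4)\cap\mathcal H^d(P(4))\big)/\mathcal H^d(B(4))$. The ordinary Steenrod kernel $K_d(4)$ is the space of linear functionals $\Psi:P^d(4)\to\mathbf F_2$ with $\Psi(\mathrm{Sq}^rf)=0$ for all $r>0$, $f\in P^{d-r}(4)$; the symmetric Steenrod kernel $K^\Sigma_d(4)$ is the space of linear functionals $\Theta:B^d(4)\to\mathbf F_2$ with $\Theta(\mathrm{Sq}^rb)=0$ for all $r>0$, $b\in B^{d-r}(4)$; and $\rho_d(\Psi)=\Psi|_{B^d(4)}$. *)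

(* Defs.v *)
From HB Require Import structures.
From mathcomp Require Import all_boot all_order perm all_algebra.
From mathcomp Require Import mpoly.

Set Implicit Arguments.
Unset Strict Implicit.
Unset Printing Implicit Defensive.

Import GRing.Theory.
Local Open Scope ring_scope.
Local Open Scope quotient_scope.

Notation P4 := {mpoly 'F_2[4]}.
Notation Pdeg d := (dhomog 4 'F_2 d).

Definition homog_part (d : nat) (f : P4) : Pdeg d := DHomog (pihomogP mdeg d f).

Definition total_sq (f : P4) : P4 :=
  f \mPo [tuple 'X_i + 'X_i ^+ 2 | i < 4].

Lemma total_sqX (i : 'I_4) : total_sq 'X_i = 'X_i + 'X_i ^+ 2.
Proof. by rewrite /total_sq comp_mpolyXU -tnth_nth tnth_mktuple. Qed.

Lemma total_sqD : {morph total_sq : f g / f + g}.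
Proof. exact: raddfD. Qed.

Lemma total_sqM : {morph total_sq : f g / f * g}.
Proof. exact: rmorphM. Qed.

Lemma total_sq1 : total_sq 1 = 1.
Proof. exact: rmorph1. Qed.

(* Sq^r raises degree by r, so for f homogeneous of degree d - r it is the
   component of degree d of the total square of f. The subtraction d - r is
   truncated: this is Sq^r only for r <= d, which holds at every use below. *)
Definition sq_fun (d r : nat) (f : Pdeg (d - r)) : Pdeg d :=
  homog_part d (total_sq (val f)).

Lemma sq_fun_is_linear d r : linear (@sq_fun d r).
Proof. by move=> c f g; apply/val_inj; rewrite /= /total_sq !linearP. Qed.

HB.instance Definition _ d r :=
  GRing.isLinear.Build 'F_2 (Pdeg (d - r)) (Pdeg d) _ (@sq_fun d r)
    (@sq_fun_is_linear d r).

Definition Sq (d r : nat) : 'Hom(Pdeg (d - r), Pdeg d) := linfun (@sq_fun d r).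

Lemma val_Sq d r (f : Pdeg (d - r)) :
  val (Sq d r f) = pihomog mdeg d (total_sq (val f)).
Proof. by rewrite lfunE. Qed.

Definition perm_vars (d : nat) (s : 'S_4) (f : Pdeg d) : Pdeg d :=
  homog_part d (msym s (val f)).

Lemma perm_vars_is_linear d s : linear (@perm_vars d s).
Proof. by move=> c f g; apply/val_inj; rewrite /= !linearP. Qed.

HB.instance Definition _ d s :=
  GRing.isLinear.Build 'F_2 (Pdeg d) (Pdeg d) _ (@perm_vars d s)
    (@perm_vars_is_linear d s).

Lemma val_perm_vars d s (f : Pdeg d) : val (perm_vars s f) = msym s (val f).
Proof.
rewrite -[LHS]/(pihomog mdeg d (msym s (val f))) -msym_pihomog.
by rewrite pihomog_dE //; apply: dhomog_is_dhomog.
Qed.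

(* A graded subspace M of P(4) is a family M : forall d, {vspace Pdeg d}. *)
Definition Pall (d : nat) : {vspace Pdeg d} := fullv.

Definition Bsym (d : nat) : {vspace Pdeg d} :=
  (\bigcap_(s : 'S_4) fixedSpace (linfun (@perm_vars d s)))%VS.

Lemma mem_Bsym d (f : Pdeg d) : (f \in Bsym d) = (val f \is symmetric).
Proof.
apply/idP/idP => [fB|/issymP fs].
  apply/issymP => s.
  have /subv_bigcapP/(_ s isT)/subvP/(_ f fB) := subvv (Bsym d).
  by move/fixedSpaceP; rewrite lfunE => /(congr1 val); rewrite val_perm_vars.
rewrite memvE; apply/subv_bigcapP => s _; rewrite -memvE.
by apply/fixedSpaceP; rewrite lfunE; apply/val_inj; rewrite val_perm_vars fs.
Qed.

Lemma msym_total_sq s (f : P4) : msym s (total_sq f) = total_sq (msym s f).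
Proof.
rewrite /total_sq msym_mPo !comp_mpolyE raddf_sum.
apply: eq_bigr => m _; rewrite [LHS]linearZ rmorph_prod; congr (_ *: _).
apply: eq_bigr => i _; rewrite rmorphXn !tnth_mktuple rmorphD rmorphXn.
have sX : msym s 'X_i = 'X_(s i) :> P4 by rewrite /msym mmapX mmap1U.
by rewrite -sX.
Qed.

Lemma Sq_sym d r (f : Pdeg (d - r)) : f \in Bsym (d - r) -> Sq d r f \in Bsym d.
Proof.
rewrite !mem_Bsym val_Sq => /issymP fs; apply: pihomog_sym.
by apply/issymP => s; rewrite msym_total_sq fs.
Qed.

Definition hits (M : forall d, {vspace Pdeg d}) (d : nat) : {vspace Pdeg d} :=
  (\sum_(1 <= r < d.+1) (Sq d r @: M (d - r)%N))%VS.

Lemma hits_Bsym d : (hits Bsym d <= Bsym d)%VS.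
Proof.
rewrite /hits; elim/big_ind: _ => [|U V sU sV|r _]; first exact: sub0v.
  by rewrite subv_add sU.
by apply/subvP => _ /memv_imgP [f fB ->]; apply: Sq_sym.
Qed.

Definition in_hits (M : forall d, {vspace Pdeg d}) (d : nat) :
  {pred subvs_of (M d)} := fun x => vsval x \in hits M d.

Lemma in_hits_zmod M d : zmod_closed (@in_hits M d).
Proof.
split=> [|x y]; first exact: mem0v.
by rewrite !unfold_in => hx hy; apply: memvB.
Qed.

HB.instance Definition _ M d :=
  GRing.isZmodClosed.Build (subvs_of (M d)) (@in_hits M d) (in_hits_zmod M d).

Notation hit_quot M d :=
  (@Quotient.quot (subvs_of (M d)) (@in_hits M d)).

(* Q_d(M) is kept as an additive group: over 'F_2 additive maps are linear, so
   nothing of the vector space structure is lost. *)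
Definition cohits (M : forall d, {vspace Pdeg d}) (d : nat) : zmodType :=
  hit_quot M d.

Definition cohit_class (M : forall d, {vspace Pdeg d}) (d : nat)
  (x : subvs_of (M d)) : cohits M d := \pi_(hit_quot M d) x.

Lemma cohit_class_eq M d (x y : subvs_of (M d)) :
  (cohit_class x == cohit_class y) = (vsval x - vsval y \in hits M d).
Proof. by rewrite -[LHS](Quotient.idealrBE (@in_hits M d)). Qed.

Lemma cohit_class_is_zmod_morphism M d : zmod_morphism (@cohit_class M d).
Proof. exact: (raddfB (\pi_(hit_quot M d))). Qed.

HB.instance Definition _ M d :=
  GRing.isZmodMorphism.Build (subvs_of (M d)) (cohits M d) (@cohit_class M d)
    (@cohit_class_is_zmod_morphism M d).

Definition cohit_repr (M : forall d, {vspace Pdeg d}) (d : nat)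
  (x : cohits M d) : subvs_of (M d) := repr (x : hit_quot M d).

Lemma cohit_reprK M d : cancel (@cohit_repr M d) (@cohit_class M d).
Proof. by move=> x; apply: reprK. Qed.

Definition incl (d : nat) (b : subvs_of (Bsym d)) : subvs_of (Pall d) :=
  vsproj (Pall d) (vsval b).

Lemma vsval_incl d (b : subvs_of (Bsym d)) : vsval (incl b) = vsval b.
Proof. by rewrite vsprojK ?memvf. Qed.

Definition cohit_map (d : nat) (x : cohits Bsym d) : cohits Pall d :=
  cohit_class (incl (cohit_repr x)).

Lemma hits_mono d : (hits Bsym d <= hits Pall d)%VS.
Proof.
rewrite /hits; apply: (big_ind2 (fun U V => (U <= V)%VS)) => //.
  by move=> *; apply: addvS.
by move=> r _; apply: limgS; apply: subvf.
Qed.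

Lemma cohit_mapE d (b : subvs_of (Bsym d)) :
  cohit_map (cohit_class b) = cohit_class (incl b).
Proof.
apply/eqP; rewrite cohit_class_eq !vsval_incl; apply: (subvP (hits_mono d)).
by rewrite -cohit_class_eq cohit_reprK.
Qed.

Lemma cohit_map_is_zmod_morphism d : zmod_morphism (@cohit_map d).
Proof.
move=> x y; rewrite -[x]cohit_reprK -[y]cohit_reprK -raddfB !cohit_mapE -raddfB.
by congr cohit_class; apply/val_inj; rewrite /= !vsval_incl.
Qed.

HB.instance Definition _ d :=
  GRing.isZmodMorphism.Build (cohits Bsym d) (cohits Pall d) (@cohit_map d)
    (@cohit_map_is_zmod_morphism d).

(* The kernel of Q_d(B(4)) -> Q_d(P(4)). *)
Definition relative_cohits (d : nat) : {pred cohits Bsym d} :=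
  [pred x | cohit_map x == 0].
Arguments relative_cohits d : clear implicits.

Lemma mem_relative_cohits d (b : subvs_of (Bsym d)) :
  (cohit_class b \in relative_cohits d) = (vsval b \in hits Pall d).
Proof.
rewrite inE cohit_mapE -(raddf0 (@cohit_class Pall d)) cohit_class_eq.
by rewrite vsval_incl subr0.
Qed.

Definition steenrod_kernel (d : nat) (Psi : 'Hom(Pdeg d, ('F_2)^o)) : Prop :=
  forall r, (0 < r <= d)%N -> forall f : Pdeg (d - r), Psi (Sq d r f) = 0.

Definition Sq_B (d r : nat) (b : subvs_of (Bsym (d - r))) : subvs_of (Bsym d) :=
  Subvs (Sq_sym (subvsP b)).

Definition sym_steenrod_kernel (d : nat)
    (Theta : 'Hom(subvs_of (Bsym d), ('F_2)^o)) : Prop :=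
  forall r, (0 < r <= d)%N ->
  forall b : subvs_of (Bsym (d - r)), Theta (Sq_B b) = 0.

Definition rho (d : nat) (Psi : 'Hom(Pdeg d, ('F_2)^o)) :
  'Hom(subvs_of (Bsym d), ('F_2)^o) := linfun (Psi \o vsval).

Lemma rhoE d Psi (b : subvs_of (Bsym d)) : rho Psi b = Psi (vsval b).
Proof. by rewrite lfunE. Qed.

Lemma rho_kernel d (Psi : 'Hom(Pdeg d, ('F_2)^o)) :
  steenrod_kernel Psi -> sym_steenrod_kernel (rho Psi).
Proof. by move=> K r rd b; rewrite rhoE; apply: K. Qed.

(* Main.v *)
(* Kameko's map f |-> x1x2x3x4 f^2 carries degree d to degree 2d + 4, and
   26 * 2^(t+1) - 4 = 2 (26 * 2^t - 4) + 4, so the degrees form one orbit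
   starting at 22. The step from d to 2d + 4 rests on two facts.

   - The operator x^(2k+1) |-> x^k (all other monomials |-> 0) commutes with the
     total square and is left inverse to Kameko's map, so it preserves hits.

   - A symmetric f of degree D = 2d + 4 without monomials having four odd
     exponents is a symmetric hit. Put E(x) = x + x^2 + x^4 + ..., so that
     Sq E(x) = x, and send x^n to the product over i of x_i^[n_i/2], times
     E(x_i) when n_i is odd. Let V be the image of f under the linear extension
     of this equivariant map: then f is the degree D part of Sq V, and V has no
     term of degree D unless D/2 + 1 is a sum of two powers of 2. Hence f is a
     sum of Sq^r of the lower components of V.

   Degree 22 is a finite computation: 129 hits in echelon form and 7 functionals
   in the Steenrod kernel together detect every symmetric polynomial. *)
From HB Require Import structures.
Require Import Defs.
From mathcomp Require Import all_boot all_order perm all_algebra.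
From mathcomp Require Import ssrcomplements mpoly.
From mathcomp Require Import zify.

Set Implicit Arguments.
Unset Strict Implicit.
Unset Printing Implicit Defensive.

Import GRing.Theory.
Local Open Scope ring_scope.

(** * Linear maps given on monomials, and the total square of a monomial *)

Lemma natr_F2 k : k%:R = (odd k)%:R :> 'F_2.
Proof. by rewrite -[LHS]Zp_nat_mod // modn2. Qed.

Lemma F2_cases (c : 'F_2) : c = 0 \/ c = 1.
Proof. by case: c => [[|[|[]]]] // i; [left|right]; apply/val_inj. Qed.

Lemma F2_sqr (c : 'F_2) : c ^+ 2 = c.
Proof. by case: (F2_cases c) => ->; rewrite ?expr0n ?expr1n. Qed.

Lemma pchar_P4 : 2 \in [pchar P4].
Proof. by apply: (rmorph_pchar (@mpolyC 4 'F_2)); rewrite pchar_Fp. Qed.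

Lemma pihomog_mpolyX d (m : 'X_{1..4}) :
  pihomog mdeg d ('X_[m] : P4) = if mdeg m == d then 'X_[m] else 0.
Proof. exact: pihomogX. Qed.

Lemma mcoeff_pihomog d (f : P4) m :
  (pihomog mdeg d f)@_m = if mdeg m == d then f@_m else 0.
Proof.
rewrite pihomogE raddf_sum [f in RHS]mpolyE raddf_sum big_mkcond /= -big_mkcond.
rewrite big_mkcond; case: ifP => md; last first.
  rewrite big1 // => k _; case: ifP => // kd; rewrite mcoeffZ mcoeffX.
  by case: eqP => [km|]; rewrite ?mulr0 //; rewrite km md in kd.
apply: eq_bigr => k _; rewrite mcoeffZ mcoeffX.
by case: (eqVneq k m) => [->|_]; rewrite ?md // mulr0 if_same.
Qed.

Definition monext (h : 'X_{1..4} -> P4) (f : P4) : P4 :=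
  \sum_(m <- msupp f) f@_m *: h m.

(** A bounded index set can be shared by several polynomials, unlike their supports, so linearity
    becomes a termwise matter. *)
Lemma monextwE h f k : (msize f <= k)%N ->
  monext h f = \sum_(m : 'X_{1..4 < k}) f@_m *: h m.
Proof.
move=> fk; rewrite /monext (big_mksub ('X_{1..4 < k})) //=; first last.
- by move=> x /msize_mdeg_lt /leq_trans; apply.
- by rewrite msupp_uniq.
by rewrite big_rmcond //= => i /memN_msupp_eq0->; rewrite scale0r.
Qed.

Lemma monext_is_linear h : linear (monext h).
Proof.
move=> c f g; pose k := maxn (msize (c *: f + g)) (maxn (msize f) (msize g)).
rewrite !(@monextwE h _ k) ?leq_max ?leqnn ?orbT //.
rewrite scaler_sumr -big_split; apply: eq_bigr => m _ /=.
by rewrite mcoeffD mcoeffZ scalerDl scalerA.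
Qed.

HB.instance Definition _ h :=
  GRing.isLinear.Build 'F_2 P4 P4 _ (monext h) (monext_is_linear h).

Lemma monextX h m : monext h 'X_[m] = h m.
Proof. by rewrite /monext msuppX big_seq1 mcoeffX eqxx scale1r. Qed.

Lemma mpoly_linear_ext (u v : {linear P4 -> P4}) :
  (forall m, u 'X_[m] = v 'X_[m]) -> u =1 v.
Proof.
move=> uv f; rewrite [f]mpolyE !raddf_sum.
by apply: eq_bigr => m _ /=; rewrite !linearZ uv.
Qed.

Lemma msym_monext s h f :
  (forall m : 'X_{1..4}, msym s (h m) = h [multinom m ((s^-1)%g i) | i < 4]) ->
  msym s (monext h f) = monext h (msym s f).
Proof.
move=> sh; apply: (mpoly_linear_ext (u := msym s \o monext h)
    (v := monext h \o msym s)).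
by move=> m /=; rewrite msymX !monextX.
Qed.

Lemma horner_algE (A : algType 'F_2) (a : A) (q : {poly 'F_2}) k :
  (size q <= k)%N -> horner_alg a q = \sum_(j < k) q`_j *: a ^+ j.
Proof.
move=> qk; have {1}-> : q = \sum_(j < k) q`_j *: 'X^j.
  rewrite -poly_def; apply/polyP=> j; rewrite coef_poly.
  by case: ltnP => // kj; rewrite nth_default // (leq_trans qk).
rewrite [LHS]raddf_sum /=; apply: eq_bigr => j _.
by rewrite linearZ /= mulr_algl rmorphXn /= horner_algX.
Qed.

(** Expand the product of sums over all choice functions [f]: distinct choices give distinct
    monomials, so only the choice [f = m] contributes. *)
Lemma mcoeff_prod_horner (q : 'I_4 -> {poly 'F_2}) m :
  (\prod_(i < 4) horner_alg ('X_i : P4) (q i))@_m = \prod_(i < 4) (q i)`_(m i).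
Proof.
(* [K] exceeds every exponent of [m], so [m] is itself one of the choice functions. *)
pose K := (\max_(i < 4) size (q i) + mdeg m).+1.
have mK i : (m i < K)%N.
  by rewrite ltnS mdegE [X in (_ + X)%N](bigD1 i) //= addnCA leq_addr.
have qK i : (size (q i) <= K)%N.
  exact: leqW (leq_trans (leq_bigmax i) (leq_addr _ _)).
rewrite (eq_bigr _ (fun i _ => horner_algE _ (qK i))) bigA_distr_bigA /=.
have termE (f : {ffun 'I_4 -> 'I_K}) :
    \prod_i ((q i)`_(f i) *: 'X_i ^+ f i) =
    (\prod_i (q i)`_(f i)) *: 'X_[[multinom (f i : nat) | i < 4]] :> P4.
  rewrite scaler_prod mpolyXE_id; congr (_ *: _).
  by apply: eq_bigr => i _; rewrite mnmE.
rewrite (eq_bigr _ (fun f _ => termE f)) raddf_sum /=.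
rewrite (bigD1 [ffun i => Ordinal (mK i)]) //= [X in _ + X]big1 => [|f fm].
  rewrite addr0 mcoeffZ mcoeffX [_ == m](_ : _ = true) ?mulr1.
    by apply: eq_bigr => i _; rewrite ffunE.
  by apply/eqP/mnmP => i; rewrite mnmE ffunE.
rewrite mcoeffZ mcoeffX; case: eqP => [fmE|]; rewrite ?mulr0 //.
case/eqP: fm; apply/ffunP => i; rewrite ffunE; apply/val_inj => /=.
by rewrite -fmE mnmE.
Qed.

Lemma mpolyX_horner m :
  'X_[m] = \prod_(i < 4) horner_alg ('X_i : P4) ('X ^+ m i).
Proof.
by rewrite mpolyXE_id; apply: eq_bigr => i _; rewrite rmorphXn /= horner_algX.
Qed.

Lemma total_sq_is_linear : linear total_sq.
Proof. by move=> c f g; rewrite /total_sq linearP. Qed.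

HB.instance Definition _ :=
  GRing.isLinear.Build 'F_2 P4 P4 _ total_sq total_sq_is_linear.

HB.instance Definition _ :=
  GRing.isMonoidMorphism.Build P4 P4 total_sq (total_sq1, total_sqM).

Lemma total_sq_horner i (q : {poly 'F_2}) :
  total_sq (horner_alg 'X_i q) = horner_alg 'X_i (q \Po ('X + 'X ^+ 2)).
Proof.
rewrite (@horner_algE _ _ q _ (leqnn (size q))) linear_sum comp_polyE.
rewrite [RHS]raddf_sum /=.
apply: eq_bigr => j _; rewrite !linearZ /= mulr_algl !rmorphXn /= rmorphD.
by rewrite /= rmorphXn /= horner_algX total_sqX.
Qed.

Lemma msym_horner s i (q : {poly 'F_2}) :
  msym s (horner_alg ('X_i : P4) q) = horner_alg 'X_(s i) q.
Proof.
rewrite !(@horner_algE _ _ q _ (leqnn (size q))) linear_sum /=.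
apply: eq_bigr => j _; rewrite !linearZ /= !rmorphXn /=.
by rewrite /msym mmapX mmap1U.
Qed.

(** The guard matters: for b < a truncated subtraction would give the value 1. *)
Definition sq_coef (a b : nat) : nat := if (a <= b)%N then 'C(a, b - a) else 0.

Lemma coef_sq_pow a b :
  (('X + 'X ^+ 2 : {poly 'F_2}) ^+ a)`_b = (sq_coef a b)%:R.
Proof.
rewrite -[X in X + _]mulr1 expr2 -mulrDr exprMn coefXnM /sq_coef ltnNge.
case: leqP => //= _; rewrite exprDn coef_sum.
under eq_bigr do rewrite expr1n mul1r coefMn coefXn.
have [ba|ab] := leqP (b - a) a.
  rewrite (bigD1 (Ordinal (ba : b - a < a.+1)%N)) //= eqxx big1 ?addr0 // => j.
  by rewrite -val_eqE /= eq_sym => /negbTE->; rewrite mul0rn.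
rewrite bin_small // big1 // => j _; case: eqP => [bj|]; rewrite ?mul0rn //.
by rewrite bj ltnNge -ltnS ltn_ord in ab.
Qed.

Lemma total_sqX_horner m : total_sq 'X_[m] =
  \prod_(i < 4) horner_alg ('X_i : P4) (('X + 'X ^+ 2) ^+ m i).
Proof.
rewrite mpolyX_horner rmorph_prod; apply: eq_bigr => i _ /=.
by rewrite total_sq_horner rmorphXn /= comp_polyX.
Qed.

Lemma mcoeff_total_sqX m k :
  (total_sq 'X_[m])@_k = \prod_(i < 4) (sq_coef (m i) (k i))%:R.
Proof.
rewrite total_sqX_horner mcoeff_prod_horner.
by apply: eq_bigr => i _; rewrite coef_sq_pow.
Qed.

(** * Kameko's maps *)

Lemma odd_bin_double a b :
  [/\ odd 'C(a.*2, b.*2) = odd 'C(a, b), odd 'C(a.*2, b.*2.+1) = false,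
      odd 'C(a.*2.+1, b.*2) = odd 'C(a, b)
    & odd 'C(a.*2.+1, b.*2.+1) = odd 'C(a, b)].
Proof.
elim: a b => [|a IHa] b.
  by case: b => [|b]; rewrite ?doubleS ?bin0 ?bin1 ?bin_small.
have C0 : odd 'C(a.+1.*2, b.*2) = odd 'C(a.+1, b).
  case: b => [|b]; first by rewrite !bin0.
  have [_ _ f3 _] := IHa b.+1; have [_ _ _ f4] := IHa b.
  by rewrite doubleS [b.+1.*2]doubleS binS oddD -doubleS f3 f4 -oddD -binS.
have C1 c : odd 'C(a.+1.*2, c.*2.+1) = false.
  by have [_ _ e3 e4] := IHa c; rewrite doubleS binS oddD e3 e4 addbb.
split=> //; last by rewrite binS oddD C0 C1.
case: b C0 => [|b] C0; first by rewrite !bin0.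
by rewrite [b.+1.*2]doubleS binS oddD -[b.*2.+2]doubleS C0 C1 addbF.
Qed.

(** The one-variable reason why Kameko's operator commutes with Sq: for even a the number 2b + 1 - a
    is odd, and an even number over an odd one is an even binomial coefficient. *)
Lemma odd_sq_coef_double a b :
  odd (sq_coef a b.*2.+1) = odd a && odd (sq_coef a./2 b).
Proof.
rewrite -{1}(odd_double_half a) /sq_coef.
move: (a./2) (odd a) => c [] /=; rewrite ?add0n ?add1n ?ltnS ?leq_double.
  case: leqP => // cb; rewrite subSS -doubleB.
  by have [_ _ ->] := odd_bin_double c (b - c).
case: ifP => // cb; rewrite (_ : _ - _ = (b - c).*2.+1)%N; last by lia.
by have [_ -> _ _] := odd_bin_double c (b - c).
Qed.

Definition all_odd (m : 'X_{1..4}) := [forall i, odd (m i)].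

Definition kameko_down := monext (fun m =>
  if all_odd m then 'X_[[multinom (m i)./2 | i < 4]] else 0).

Lemma kameko_downB f g : kameko_down (f - g) = kameko_down f - kameko_down g.
Proof. exact: raddfB. Qed.

Definition kameko_up (f : P4) : P4 := 'X_[[multinom 1 | _ < 4]] * f ^+ 2.

Lemma kameko_up0 : kameko_up 0 = 0.
Proof. by rewrite /kameko_up expr0n mulr0. Qed.

Definition mnm_up (k : 'X_{1..4}) := [multinom (k i).*2.+1 | i < 4].

Lemma all_oddP m : reflect (exists k, m = mnm_up k) (all_odd m).
Proof.
apply: (iffP forallP) => [mo|[k ->] i]; last by rewrite mnmE /= odd_double.
exists [multinom (m i)./2 | i < 4]; apply/mnmP => i; rewrite !mnmE.
by rewrite -[LHS]odd_double_half mo.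
Qed.

Lemma half_mnm_up k : [multinom (mnm_up k i)./2 | i < 4] = k.
Proof. by apply/mnmP => i; rewrite !mnmE /= uphalf_double. Qed.

Lemma mnm_up_inj : injective mnm_up.
Proof. by move=> k l kl; rewrite -[k]half_mnm_up kl half_mnm_up. Qed.

Lemma mdeg_up k : mdeg (mnm_up k) = ((mdeg k).*2 + 4)%N.
Proof. by rewrite !mdegE !big_ord_recl !big_ord0 !mnmE; lia. Qed.

Lemma mcoeff_kameko_down f k : (kameko_down f)@_k = f@_(mnm_up k).
Proof.
rewrite /kameko_down /monext raddf_sum [f in RHS]mpolyE raddf_sum /=.
apply: eq_bigr => m _; rewrite !mcoeffZ mcoeffX; congr (_ * _).
case: all_oddP => [[l ->]|no_k].
  by rewrite half_mnm_up mcoeffX (inj_eq mnm_up_inj).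
by rewrite mcoeff0; case: eqP => // mk; case: no_k; exists k.
Qed.

(** On a monomial, the coefficient at [mnm_up k] is a product over the variables, and
    [odd_sq_coef_double] splits each factor into the parity of the exponent and a coefficient for
    the halved exponents. *)
Lemma kameko_down_total_sq f :
  kameko_down (total_sq f) = total_sq (kameko_down f).
Proof.
apply: (mpoly_linear_ext (u := kameko_down \o total_sq)
  (v := total_sq \o kameko_down)) => m /=.
apply/mpolyP => k; rewrite mcoeff_kameko_down mcoeff_total_sqX monextX.
have factorE i : (sq_coef (m i) (mnm_up k i))%:R =
    (odd (m i))%:R * (sq_coef (m i)./2 (k i))%:R :> 'F_2.
  rewrite mnmE natr_F2 odd_sq_coef_double -mulnb natrM.
  by rewrite [in RHS](natr_F2 (sq_coef _ _)).
rewrite (eq_bigr _ (fun i _ => factorE i)); case: ifPn => [/forallP mo|].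
  rewrite mcoeff_total_sqX; apply: eq_bigr => i _.
  by rewrite mo mul1r mnmE.
rewrite negb_forall => /existsP[i /negbTE mi].
by rewrite (bigD1 i) //= mi !mul0r raddf0 mcoeff0.
Qed.

(** Squaring is the Frobenius map, which is additive and fixes the coefficients. *)
Lemma sqr_monext h f : monext h f ^+ 2 = monext (fun m => h m ^+ 2) f.
Proof.
rewrite /monext -(pFrobenius_autE pchar_P4) raddf_sum; apply: eq_bigr => m _.
by rewrite /= pFrobenius_autE exprZn F2_sqr.
Qed.

Lemma monext_id f : monext (fun m => 'X_[m]) f = f.
Proof. by rewrite [RHS]mpolyE. Qed.

Lemma kameko_upE f : kameko_up f = monext (fun m => 'X_[mnm_up m]) f.
Proof.
rewrite /kameko_up -[f in LHS]monext_id sqr_monext /monext mulr_sumr.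
apply: eq_bigr => m _; rewrite -scalerAr mpolyXn -mpolyXD; congr (_ *: 'X_[_]).
by apply/mnmP => i; rewrite mnmDE mulmnE !mnmE; lia.
Qed.

Lemma mcoeff_kameko_up f k : (kameko_up f)@_(mnm_up k) = f@_k.
Proof.
rewrite kameko_upE /monext raddf_sum [f in RHS]mpolyE raddf_sum /=.
by apply: eq_bigr => m _; rewrite !mcoeffZ !mcoeffX (inj_eq mnm_up_inj).
Qed.

Lemma kameko_upK : cancel kameko_up kameko_down.
Proof.
move=> f; apply/mpolyP => k.
by rewrite mcoeff_kameko_down mcoeff_kameko_up.
Qed.

(** Hence [f - kameko_up (kameko_down f)] is the part of [f] without all-odd monomials. *)
Lemma kameko_downK f :
  kameko_up (kameko_down f) =
  monext (fun m => if all_odd m then 'X_[m] else 0) f.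
Proof.
rewrite /kameko_up sqr_monext /monext mulr_sumr; apply: eq_bigr => m _.
rewrite -scalerAr; congr (_ *: _); case: all_oddP => [[k ->]|_].
  rewrite half_mnm_up mpolyXn -mpolyXD; congr 'X_[_].
  by apply/mnmP => i; rewrite mnmDE mulmnE !mnmE; lia.
by rewrite expr0n mulr0.
Qed.

Lemma kameko_down_pihomog d f :
  kameko_down (pihomog mdeg (d.*2 + 4) f) = pihomog mdeg d (kameko_down f).
Proof.
apply/mpolyP => k; rewrite mcoeff_pihomog !mcoeff_kameko_down mcoeff_pihomog.
by rewrite mdeg_up eqn_add2r (inj_eq double_inj).
Qed.

Lemma kameko_up_pihomog d f :
  kameko_up (pihomog mdeg d f) = pihomog mdeg (d.*2 + 4) (kameko_up f).
Proof.
rewrite !kameko_upE; apply: (mpoly_linear_ext (u := monext _ \o pihomog mdeg d)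
  (v := pihomog mdeg (d.*2 + 4) \o monext _)) => m /=.
rewrite monextX !pihomog_mpolyX mdeg_up eqn_add2r (inj_eq double_inj).
by case: ifP => _; rewrite ?monextX // raddf0.
Qed.

Lemma kameko_down_sym f : f \is symmetric -> kameko_down f \is symmetric.
Proof.
move=> /issymP fs; apply/issymP => s; apply/mpolyP => k.
rewrite mcoeff_sym !mcoeff_kameko_down -[in RHS](fs s) mcoeff_sym.
by congr (_@__); apply/mnmP => i; rewrite !mnmE.
Qed.

Lemma kameko_up_sym f : f \is symmetric -> kameko_up f \is symmetric.
Proof.
move=> /issymP fs; apply/issymP => s.
rewrite msymM rmorphXn /= fs msymX; congr ('X_[_] * _).
by apply/mnmP => i; rewrite !mnmE.
Qed.

(** * Hit polynomials *)

Lemma homog_part_is_linear d : linear (homog_part d).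
Proof. by move=> c f g; apply/val_inj; rewrite /= linearP. Qed.

HB.instance Definition _ d :=
  GRing.isLinear.Build 'F_2 P4 (Pdeg d) _ (homog_part d)
    (homog_part_is_linear d).

Lemma val_homog_part d f : val (homog_part d f) = pihomog mdeg d f.
Proof. by []. Qed.

Lemma homog_partK d (f : Pdeg d) : homog_part d (val f) = f.
Proof. by apply/val_inj; rewrite /= pihomog_dE // dhomog_is_dhomog. Qed.

(** Sq never lowers an exponent, so a term of Sq(x^m) of degree at most that of x^m can only be x^m
    itself, which is subtracted. *)
Lemma pihomog_total_sq_ge d e f : (d <= e)%N ->
  pihomog mdeg d (total_sq (pihomog mdeg e f) - pihomog mdeg e f) = 0.
Proof.
move=> de; apply/eqP; move: f.
suff h m : pihomog mdeg d (total_sq (pihomog mdeg e 'X_[m]) -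
    pihomog mdeg e ('X_[m] : P4)) = 0.
  move=> f; apply/eqP; rewrite [f]mpolyE [pihomog _ e _]raddf_sum /= raddf_sum.
  rewrite -sumrB raddf_sum big1 // => m _.
  by rewrite linearZ /= [total_sq _]linearZ -scalerBr linearZ /= h scaler0.
rewrite pihomog_mpolyX; case: eqP => [me|_]; last first.
  by rewrite [total_sq 0]raddf0 subrr raddf0.
apply/mpolyP => k; rewrite mcoeff0 mcoeff_pihomog; case: eqP => // kd.
rewrite mcoeffB mcoeff_total_sqX mcoeffX.
have [<-|mk] := eqVneq m k.
  by rewrite big1 ?subrr // => i _; rewrite /sq_coef leqnn subnn bin0.
suff [i ki] : exists i, (k i < m i)%N.
  by rewrite (bigD1 i) //= /sq_coef leqNgt ki mul0r subr0.
apply/existsP; apply: contraNT mk; rewrite negb_exists => /forallP mk.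
have {}mk i : (m i <= k i)%N by rewrite leqNgt mk.
apply/eqP/mnmP => i; apply/eqP; rewrite eqn_leq mk /=.
have := leq_trans de (eq_leq (esym me)); rewrite -kd !mdegE.
rewrite (bigD1 i) //= [X in (_ <= X)%N](bigD1 i) //= leqNgt; apply: contraNT.
rewrite -ltnNge => mki; rewrite -addSn leq_add //.
by apply: leq_sum => j _; apply: mk.
Qed.

(** Closure properties of a predicate on inhomogeneous polynomials let the next lemmas on hits cover
    P(4) and B(4) at once. *)
Definition graded_by (S : {pred P4}) (M : forall d, {vspace Pdeg d}) :=
  [/\ forall d (f : Pdeg d), (f \in M d) = (val f \in S), 0 \in S,
      {in S &, forall f g, f + g \in S}
    & forall d f, f \in S -> pihomog mdeg d f \in S].

Lemma Pall_graded : graded_by predT Pall.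
Proof. by split=> // d f; rewrite memvf. Qed.

Lemma Bsym_graded : graded_by [pred f | f \is symmetric] Bsym.
Proof.
split=> [d f||f g|d f]; rewrite !inE.
- exact: mem_Bsym.
- exact: rpred0.
- exact: rpredD.
- exact: pihomog_sym.
Qed.

(** Split [f] into components: one of degree e >= d contributes nothing, and one of degree e < d
    contributes its image under Sq^(d-e). *)
Lemma hits_total_sq S M d f : graded_by S M -> f \in S ->
  homog_part d (total_sq f - f) \in hits M d.
Proof.
move=> [SM _ _ Sp] fS.
rewrite [X in total_sq X - X](pihomog_partitionE (leqnn (msize f))).
rewrite raddf_sum -sumrB raddf_sum /=; apply: memv_suml => e _.
have [de|ed] := leqP d e.
  suff -> : homog_part d (total_sq (pihomog mdeg e f) - pihomog mdeg e f) = 0.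
    exact: mem0v.
  by apply/val_inj; apply: pihomog_total_sq_ge.
have -> : homog_part d (total_sq (pihomog mdeg e f) - pihomog mdeg e f) =
    Sq d (d - e) (homog_part (d - (d - e)) f).
  apply/val_inj; rewrite val_Sq /= subKn ?(ltnW ed) // raddfB /=.
  rewrite (pihomog_ne0 (mf := mdeg) (p := pihomog mdeg e f) _ (pihomogP _ _ _)).
    by rewrite subr0.
  by rewrite ltn_eqF.
have /subvP : (Sq d (d - e) @: M (d - (d - e))%N <= hits M d)%VS.
  rewrite /hits (bigD1_seq (d - e)%N) ?iota_uniq ?mem_index_iota ?addvSl //=.
  by rewrite subn_gt0 ed ltnS leq_subr.
by apply; apply: memv_img; rewrite SM Sp.
Qed.

(** The sources of the various Sq^r add up to one inhomogeneous polynomial. Since [msize] is the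
    degree plus one, [msize f <= d] means degree less than d and encodes r > 0. *)
Lemma hits_exists S M d (x : Pdeg d) : graded_by S M -> x \in hits M d ->
  exists f, [/\ f \in S, (msize f <= d)%N
    & val x = pihomog mdeg d (total_sq f)].
Proof.
move=> [SM S0 SD _]; rewrite /hits big_nat.
elim/big_ind: _ x => [|U V IHU IHV|r /andP[r_gt0 rd]] x.
- rewrite memv0 => /eqP ->; exists 0; split; [exact: S0 | by rewrite msize0 |].
  by rewrite [total_sq 0]raddf0 pihomog0.
- case/memv_addP => u /IHU[f [fS fd uE]] [v /IHV[g [gS gd vE]] ->].
  exists (f + g); split; first exact: SD.
    by rewrite (leq_trans (msizeD_le _ _)) // geq_max fd.
  rewrite total_sqD pihomogD [LHS](raddfD (@mpoly_of_dhomog 4 'F_2 d)).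
  by congr (_ + _); [exact: uE | exact: vE].
case/memv_imgP=> f fM ->; exists (val f).
rewrite -SM fM val_Sq; split=> //.
have := dhomog_is_dhomog f; rewrite msizeE => /dhomogP fh.
apply/bigmax_leqP_seq => m mf _; rewrite [mdeg m](fh m mf); lia.
Qed.

(** * Symmetric polynomials without all-odd monomials *)

(* Truncating x + x^2 + x^4 + ... to N terms turns its image x under Sq into
   x + x^(2^N), which is harmless in degrees below 2^N. *)
Definition sq_lift1 (N n : nat) : {poly 'F_2} :=
  'X ^+ n./2 * (if odd n then \sum_(j < N) 'X ^+ (2 ^ j) else 1).

(** In characteristic 2 the power (x + x^2)^(2^j) is x^(2^j) + x^(2^(j+1)), so the sum
    telescopes. *)
Lemma comp_sq_lift1 N n : sq_lift1 N n \Po ('X + 'X ^+ 2) =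
  ('X + 'X ^+ 2) ^+ n./2 * (if odd n then 'X + 'X ^+ (2 ^ N) else 1).
Proof.
rewrite /sq_lift1 rmorphM /= rmorphXn /= comp_polyX; congr (_ * _).
case: ifP => _; last by rewrite rmorph1.
have pchar_poly2 : 2 \in [pchar {poly 'F_2}].
  by apply: (rmorph_pchar (@polyC 'F_2)); rewrite pchar_Fp.
elim: N => [|N IHN]; first by rewrite big_ord0 rmorph0 addrr_pchar2.
rewrite big_ord_recr /= rmorphD /= IHN rmorphXn /= comp_polyX.
have -> : ('X + 'X ^+ 2) ^+ (2 ^ N) =
    'X ^+ (2 ^ N) + 'X ^+ (2 ^ N.+1) :> {poly 'F_2}.
  elim: N {IHN} => [|N IHN]; first by rewrite !expr1.
  rewrite !expnSr exprM IHN -!(pFrobenius_autE pchar_poly2) rmorphD /=.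
  by rewrite !pFrobenius_autE -!exprM !expnSr.
by rewrite addrA addrK_pchar2.
Qed.

(** Below degree 2^N the image is (x + x^2)^[n/2], times x if n is odd. Its top term is x^n, but
    lower terms may occur, whence the bound n <= k. *)
Lemma coef_comp_sq_lift1 N n k : (n <= k < 2 ^ N)%N ->
  (sq_lift1 N n \Po ('X + 'X ^+ 2))`_k = (n == k)%:R.
Proof.
have sq_coef_top a b : (a.*2 <= b)%N -> sq_coef a b = (a.*2 == b).
  move=> ab; rewrite /sq_coef ifT; last by lia.
  have [<-|] := eqVneq; first by rewrite -addnn addnK binn.
  by move=> ne; rewrite bin_small //; lia.
case/andP=> nk kN; rewrite comp_sq_lift1; move: nk.
rewrite -{1 4}(odd_double_half n); case: (odd n) => /= nk.
  rewrite mulrDr coefD coefMX coefMXn kN addr0.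
  rewrite gtn_eqF ?coef_sq_pow; last by lia.
  rewrite sq_coef_top; last by lia.
  by congr _%:R; congr nat_of_bool; apply/eqP/eqP; lia.
by rewrite mulr1 coef_sq_pow sq_coef_top.
Qed.

Lemma coef_sq_lift1 N n k : (sq_lift1 N n)`_k != 0 ->
  exists j, k = (n./2 + odd n * 2 ^ j)%N.
Proof.
rewrite /sq_lift1 coefXnM; case: ltnP => [_|nk]; first by rewrite eqxx.
case: (odd n); last first.
  rewrite coef1; have [k0 _|_] := eqVneq (k - n./2)%N 0%N; last by rewrite eqxx.
  by exists 0%N; rewrite mul0n addn0; lia.
rewrite coef_sum => h.
suff /existsP[j /eqP jE] : [exists j : 'I_N, k - n./2 == 2 ^ j]%N.
  by exists j; rewrite mul1n -jE subnKC.
apply: contraNT h; rewrite negb_exists => /forallP h.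
by rewrite big1 // => j _; rewrite coefXn (negbTE (h j)).
Qed.

(** Truncation length d suffices: exponents in degree d are at most d < 2^d. *)
Definition sq_lift (d : nat) := monext (fun m =>
  if (mdeg m == d) && ~~ all_odd m
  then \prod_(i < 4) horner_alg ('X_i : P4) (sq_lift1 d (m i)) else 0).


(** A monomial x^k of degree d other than x^m has some k_i > m_i, and there the i-th factor of Sq of
    the lift has coefficient 0 by [coef_comp_sq_lift1]. *)
Lemma total_sq_lift d f : pihomog mdeg d (total_sq (sq_lift d f)) =
  pihomog mdeg d (f - kameko_up (kameko_down f)).
Proof.
have -> : f - kameko_up (kameko_down f) =
    monext (fun m => if all_odd m then 0 else 'X_[m]) f.
  rewrite kameko_downK -[X in X - _]monext_id /monext -sumrB.
  apply: eq_bigr => m _; rewrite -scalerBr; congr (_ *: _).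
  by case: ifP => _; rewrite ?subrr ?subr0.
apply: (mpoly_linear_ext (u := pihomog mdeg d \o total_sq \o sq_lift d)
  (v := pihomog mdeg d \o monext _)) => m /=.
rewrite !monextX; case: (all_odd m); first by rewrite andbF [total_sq 0]raddf0.
rewrite andbT pihomog_mpolyX; case: eqP => md; last first.
  by rewrite [total_sq 0]raddf0 pihomog0.
apply/mpolyP => k; rewrite mcoeff_pihomog mcoeffX; case: eqP => kd; last first.
  by case: eqP => // mk; rewrite -mk in kd.
rewrite rmorph_prod /= (eq_bigr _ (fun i _ => total_sq_horner _ _)).
rewrite mcoeff_prod_horner.
have kN i : (k i < 2 ^ d)%N.
  by rewrite (leq_ltn_trans _ (ltn_expl d _)) // -kd mdegE (bigD1 i) ?leq_addr.
have [<-|mk] := eqVneq m k.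
  rewrite big1 // => i _; rewrite coef_comp_sq_lift1 ?eqxx // leqnn /=.
  by rewrite (leq_ltn_trans _ (ltn_expl d _)) // -md mdegE (bigD1 i) ?leq_addr.
suff [i mi] : exists i, (m i < k i)%N.
  rewrite (bigD1 i) //= coef_comp_sq_lift1; last by rewrite kN (ltnW mi).
  by rewrite ltn_eqF // mul0r.
apply/existsP; apply: contraNT mk; rewrite negb_exists => /forallP mk.
have {}mk i : (k i <= m i)%N by rewrite leqNgt mk.
apply/eqP/mnmP => i; apply/eqP; rewrite eqn_leq mk andbT leqNgt.
apply/negP => mi.
suff : (mdeg k < mdeg m)%N by rewrite kd md ltnn.
rewrite !mdegE (bigD1 i) //= [X in (_ < X)%N](bigD1 i) //= -addSn leq_add //.
by apply: leq_sum => j _; apply: mk.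
Qed.

Lemma all_oddE m : all_odd m = [&& odd (m ord0), odd (m (lift ord0 ord0)),
  odd (m (lift ord0 (lift ord0 ord0)))
  & odd (m (lift ord0 (lift ord0 (lift ord0 ord0))))].
Proof.
apply/forallP/and4P => [mo|[o0 o1 o2 o3] [[|[|[|[|j]]]] j4]] //=.
- by rewrite (_ : Ordinal _ = ord0) //; apply: val_inj.
- by rewrite (_ : Ordinal _ = lift ord0 ord0) //; apply: val_inj.
- by rewrite (_ : Ordinal _ = lift ord0 (lift ord0 ord0)) //; apply: val_inj.
- rewrite (_ : Ordinal _ = lift ord0 (lift ord0 (lift ord0 ord0))) //.
  exact: val_inj.
Qed.

(** If x^m has degree 2d and r odd exponents, a term of its lift has degree d - r/2 plus r powers of
    2. Here r is even and not 4: r = 0 gives degree d < 2d, and r = 2 gives 2d only if 2^i + 2^j = d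
    + 1. *)
Lemma pihomog_sq_lift d f :
  (0 < d)%N -> (forall i j, 2 ^ i + 2 ^ j != d.+1)%N ->
  pihomog mdeg d.*2 (sq_lift d.*2 f) = 0.
Proof.
move=> d_gt0 dij; apply/mpolyP => k; rewrite mcoeff_pihomog mcoeff0.
case: eqP => // kd; rewrite /sq_lift /monext raddf_sum big1 //= => m _.
rewrite mcoeffZ; case: ifP => [/andP[/eqP md mo]|_]; last first.
  by rewrite mcoeff0 mulr0.
rewrite mcoeff_prod_horner; apply/eqP; rewrite mulf_eq0; apply/orP; right.
apply: contraT => /prodf_neq0 kE.
have {}kE i : exists j, k i = ((m i)./2 + odd (m i) * 2 ^ j)%N.
  exact: coef_sq_lift1 (kE i isT).
have [[j0 k0] [j1 k1]] := (kE ord0, kE (lift ord0 ord0)).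
have [j2 k2] := kE (lift ord0 (lift ord0 ord0)).
have [j3 k3] := kE (lift ord0 (lift ord0 (lift ord0 ord0))).
move: kd md mo; rewrite all_oddE !mdegE.
rewrite !big_ord_recl !big_ord0 {}k0 {}k1 {}k2 {}k3.
(* Any two of the four exponents may be the odd ones, so all six pairs are supplied. *)
move: (dij j0 j1) (dij j0 j2) (dij j0 j3) (dij j1 j2) (dij j1 j3) (dij j2 j3).
move: (2 ^ j0)%N (2 ^ j1)%N (2 ^ j2)%N (2 ^ j3)%N => e0 e1 e2 e3.
move: (m _) (m _) (m _) (m _) => m0 m1 m2 m3.
move: (odd_double_half m0) (odd_double_half m1).
move: (odd_double_half m2) (odd_double_half m3).
move: (odd m0) (odd m1) (odd m2) (odd m3) => b0 b1 b2 b3.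
move: (m0./2) (m1./2) (m2./2) (m3./2) => h0 h1 h2 h3.
by case: b0; case: b1; case: b2; case: b3 => //=; lia.
Qed.

(** Each variable gets the same one-variable recipe, and degree and all-oddness ignore the order of
    the exponents. *)
Lemma sq_lift_sym d f : f \is symmetric -> sq_lift d f \is symmetric.
Proof.
move=> /issymP fs; apply/issymP => s.
rewrite -[f in RHS](fs s); apply: msym_monext => m.
set m' := [multinom _ | i < 4].
have -> : mdeg m' = mdeg m.
  rewrite !mdegE [RHS](reindex_inj (@perm_inj _ (s^-1)%g)).
  by apply: eq_bigr => i _; rewrite mnmE.
have -> : all_odd m' = all_odd m.
  apply/forallP/forallP => mo i; last by rewrite mnmE.
  by have := mo (s i); rewrite mnmE permK.
case: (_ && _); last exact: msym0.
rewrite rmorph_prod [RHS](reindex_inj (@perm_inj _ s)) /=.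
by apply: eq_bigr => i _; rewrite msym_horner mnmE permK.
Qed.

(** The lift has no component of degree 2d, so subtracting it from its total square is harmless
    there and makes [hits_total_sq] applicable. *)
Lemma hits_Bsym_down d f : (0 < d)%N ->
  (forall i j, 2 ^ i + 2 ^ j != d.+1)%N -> f \is symmetric ->
  homog_part d.*2 (f - kameko_up (kameko_down f)) \in hits Bsym d.*2.
Proof.
move=> d_gt0 dij fs.
have -> : homog_part d.*2 (f - kameko_up (kameko_down f)) =
    homog_part d.*2 (total_sq (sq_lift d.*2 f) - sq_lift d.*2 f).
  apply/val_inj; rewrite !val_homog_part [RHS]raddfB /= pihomog_sq_lift //.
  by rewrite subr0 total_sq_lift.
by apply: (hits_total_sq _ Bsym_graded); rewrite inE sq_lift_sym.
Qed.

(** * The step from degree d to degree 2d + 4 *)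

Lemma pihomog_ge d (f : P4) : (msize f <= d)%N -> pihomog mdeg d f = 0.
Proof.
move=> fd; apply/mpolyP => m; rewrite mcoeff_pihomog mcoeff0.
by case: eqP => // md; apply/memN_msupp_eq0/msize_mdeg_ge; rewrite md.
Qed.

(** [kameko_down] sends [b] to a symmetric [c] that is hit in P(4), hence by hypothesis hit in B(4).
    As [b] is [kameko_up c] plus a part without all-odd monomials, it remains to see that
    [kameko_up c] is a symmetric hit. *)
Lemma hits_kameko d : (forall i j, 2 ^ i + 2 ^ j != d + 3)%N ->
  (Bsym d :&: hits Pall d <= hits Bsym d)%VS ->
  (Bsym (d.*2 + 4) :&: hits Pall (d.*2 + 4) <= hits Bsym (d.*2 + 4))%VS.
Proof.
move=> dij IH; apply/subvP => b; rewrite memv_cap => /andP[bB bP].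
set D := (d.*2 + 4)%N in b bB bP *.
have DE : D = (d.+2).*2 by rewrite /D; lia.
(* Here D/2 + 1 = d + 3, which explains the hypothesis on powers of 2. *)
have hits_down f : f \is symmetric ->
    homog_part D (f - kameko_up (kameko_down f)) \in hits Bsym D.
  rewrite DE => fs; apply: hits_Bsym_down => // i j.
  by have := dij i j; rewrite addn3.
have [g [_ gD bE]] := hits_exists Pall_graded bP.
have bs : val b \is symmetric by rewrite -mem_Bsym.
pose c := homog_part d (kameko_down (val b)).
have cE : val c = kameko_down (val b).
  rewrite val_homog_part -kameko_down_pihomog pihomog_dE //.
  exact: dhomog_is_dhomog.
have cP : c \in hits Pall d.
  (* [g] has no component of degree [D], so subtracting [kameko_down g] changes nothing in degree
     [d]. *)
  suff -> : c = homog_part d (total_sq (kameko_down g) - kameko_down g).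
    exact: (hits_total_sq _ Pall_graded).
  apply/val_inj; rewrite cE bE val_homog_part -kameko_down_total_sq -raddfB.
  by rewrite -kameko_down_pihomog raddfB /= (pihomog_ge gD) subr0.
have cB : c \in Bsym d by rewrite mem_Bsym cE kameko_down_sym.
have [f [fs fd cfE]] : exists f, [/\ f \in [pred f : P4 | f \is symmetric],
    (msize f <= d)%N & val c = pihomog mdeg d (total_sq f)].
  by apply: (hits_exists Bsym_graded); apply: (subvP IH); rewrite memv_cap cB.
rewrite inE in fs.
(* [kameko_up] does not commute with Sq, but the defect [R] is symmetric and killed by
   [kameko_down], so [hits_down] makes its degree [D] part a symmetric hit. *)
pose R := total_sq (kameko_up f) - kameko_up (total_sq f).
have Rs : R \is symmetric.
  apply: rpredB; last apply: kameko_up_sym.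
    by apply/issymP => s; rewrite msym_total_sq (issymP _ (kameko_up_sym fs)).
  by apply/issymP => s; rewrite msym_total_sq (issymP _ fs).
have dR : kameko_down R = 0.
  by rewrite kameko_downB kameko_down_total_sq !kameko_upK subrr.
have RD : homog_part D R \in hits Bsym D.
  by rewrite -[R]subr0 -kameko_up0 -dR hits_down.
have upD : homog_part D (kameko_up (val c)) =
    homog_part D (total_sq (kameko_up f) - kameko_up f) - homog_part D R.
  rewrite -raddfB cfE; apply/val_inj; rewrite !val_homog_part.
  have -> : total_sq (kameko_up f) - kameko_up f - R =
      kameko_up (total_sq f) - kameko_up f.
    by rewrite /R opprB addrC addrA subrK.
  rewrite kameko_up_pihomog pihomog_id pihomogB.
  by rewrite -[pihomog _ D (kameko_up f)]kameko_up_pihomog (pihomog_ge fd)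
    kameko_up0 subr0.
have -> : b = homog_part D (val b - kameko_up (kameko_down (val b))) +
    homog_part D (kameko_up (val c)).
  by rewrite cE -raddfD subrK; apply/esym/homog_partK.
apply: memvD; first exact: hits_down.
rewrite upD; apply: memvB; last exact: RD.
by apply: (hits_total_sq _ Bsym_graded); rewrite inE kameko_up_sym.
Qed.

(** The right side is odd, so one power would be 1 and the other 2(13 * 2^t - 1). But 13 * 2^t - 1
    is 12 for t = 0, and odd and greater than 1 for t > 0. *)
Lemma two_pow2_neq i j t : (2 ^ i + 2 ^ j != 26 * 2 ^ t - 1)%N.
Proof.
have pow2P k : (2 ^ k = 1 \/ exists l, 2 ^ k = 2 * 2 ^ l /\ 0 < 2 ^ l)%N.
  case: k => [|k]; [by left | right; exists k].
  by rewrite expnS expn_gt0.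
have odd_half l : (2 ^ l != 13 * 2 ^ t - 1)%N.
  apply/eqP; case: (pow2P t) => [->|[t' [-> t0]]].
    case: (pow2P l) => [->|[l1 [-> _]]]; first by lia.
    case: (pow2P l1) => [->|[l2 [-> _]]]; first by lia.
    by case: (pow2P l2) => [->|[l3 [-> _]]]; lia.
  by case: (pow2P l) => [->|[l1 [-> _]]]; lia.
have t0 : (0 < 2 ^ t)%N by rewrite expn_gt0.
apply/eqP; case: (pow2P i) (pow2P j) => [->|[i' [-> _]]] [->|[j' [-> _]]].
- by lia.
- by have /eqP := odd_half j'; lia.
- by have /eqP := odd_half i'; lia.
- by lia.
Qed.

Lemma hits_kameko_iter t :
  (Bsym 22 :&: hits Pall 22 <= hits Bsym 22)%VS ->
  (Bsym (26 * 2 ^ t - 4) :&: hits Pall (26 * 2 ^ t - 4)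
     <= hits Bsym (26 * 2 ^ t - 4))%VS.
Proof.
move=> h22; elim: t => [|t IHt]; first by rewrite muln1.
have t0 : (0 < 2 ^ t)%N by rewrite expn_gt0.
have -> : (26 * 2 ^ t.+1 - 4 = (26 * 2 ^ t - 4).*2 + 4)%N by rewrite expnS; lia.
apply: hits_kameko => // i j.
by rewrite (_ : _ + 3 = 26 * 2 ^ t - 1)%N ?two_pow2_neq //; lia.
Qed.

(** * Degree 22 *)

(* Lucas' criterion, reading k binary digits. *)
Fixpoint bin_odd (k a b : nat) : bool :=
  if k is k'.+1 then (odd b ==> odd a) && bin_odd k' a./2 b./2 else true.

Lemma bin_oddE k a b : (a < 2 ^ k)%N -> (b < 2 ^ k)%N ->
  bin_odd k a b = odd 'C(a, b).
Proof.
elim: k a b => [|k IHk] a b /=; first by case: a b => [|a] [|b].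
rewrite !expnS => ak bk; rewrite IHk; [|lia|lia].
rewrite -[in RHS](odd_double_half a) -[in RHS](odd_double_half b).
have [] := odd_bin_double a./2 b./2.
by case: (odd a); case: (odd b) => //=; rewrite ?add0n ?add1n => -> -> -> ->.
Qed.

(** Five binary digits cover all exponents below 32, enough for degree 22. *)
Definition sq_bit (a b : nat) : bool := (a <= b)%N && bin_odd 5 a (b - a).

Lemma sq_bitE a b : (b < 32)%N -> odd (sq_coef a b) = sq_bit a b.
Proof.
move=> b32; rewrite /sq_bit /sq_coef; case: leqP => // ab.
by rewrite andTb bin_oddE //; [lia|rewrite (leq_ltn_trans (leq_subr _ _))].
Qed.

(** Plain lists of exponents allow the tables to be checked by evaluation. *)
Definition exps (m : 'X_{1..4}) : seq nat := [seq m i | i <- enum 'I_4].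
Definition mnm_of (s : seq nat) : 'X_{1..4} := [multinom nth 0%N s i | i < 4].

Fixpoint sq_bits (s t : seq nat) : bool :=
  if s is a :: s' then sq_bit a (head 0%N t) && sq_bits s' (behead t) else true.

Lemma enum4 : enum 'I_4 = [:: ord0; lift ord0 ord0; lift ord0 (lift ord0 ord0);
  lift ord0 (lift ord0 (lift ord0 ord0))].
Proof. by apply: (inj_map val_inj); rewrite val_enum_ord. Qed.

Lemma exps_of s : size s = 4 -> exps (mnm_of s) = s.
Proof.
by case: s => [|a [|b [|c [|d []]]]] // _; rewrite /exps enum4 /= !mnmE.
Qed.

Lemma mnm_of_exps m : mnm_of (exps m) = m.
Proof.
apply/mnmP => i; rewrite mnmE /exps (nth_map ord0) ?size_enum_ord //.
by rewrite nth_ord_enum.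
Qed.

Lemma size_exps m : size (exps m) = 4.
Proof. by rewrite size_map size_enum_ord. Qed.

Lemma sumn_exps m : sumn (exps m) = mdeg m.
Proof. by rewrite mdegE /exps enum4 /= !big_ord_recl big_ord0. Qed.

Lemma mdeg_of s : size s = 4 -> mdeg (mnm_of s) = sumn s.
Proof. by move=> s4; rewrite -sumn_exps exps_of. Qed.

Lemma mcoeff_total_sq_bits m t : size t = 4 -> (sumn t < 32)%N ->
  (total_sq 'X_[m])@_(mnm_of t) = (sq_bits (exps m) t)%:R.
Proof.
case: t => [|t0 [|t1 [|t2 [|t3 []]]]] //= _ t32.
rewrite mcoeff_total_sqX !big_ord_recl big_ord0 /exps enum4 /= !mnmE /=.
rewrite !andbT mulr1 [X in X * _]natr_F2 [X in _ * (X * _)]natr_F2.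
rewrite [X in _ * (_ * (X * _))]natr_F2 [X in _ * (_ * (_ * X))]natr_F2.
by rewrite !sq_bitE ?mulnb -?natrM ?mulnb //; lia.
Qed.

(* Checks that the sum of the coefficients at the exponents of S vanishes on
   Sq(x^m) for every m of length k and weight less than D, filtering S by one
   coordinate of m at a time. *)
Fixpoint kills_sq (k D : nat) (S : seq (seq nat)) : bool :=
  if k is k'.+1 then
    (S == [::]) || all (fun a =>
      kills_sq k' (D - a)
        [seq behead s | s <- S & sq_bit a (head 0%N s)]) (iota 0 D)
  else ~~ odd (size S).

Lemma kills_sqP k D S s : kills_sq k D S -> size s = k -> (sumn s < D)%N ->
  ~~ odd (count (sq_bits s) S).
Proof.
elim: k D S s => [|k IHk] D S [|a s] //=.
case/orP => [/eqP-> //|/allP ks [sk] aD].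
have aI : a \in iota 0 D by rewrite mem_iota; lia.
have := IHk _ _ _ (ks a aI) sk; rewrite count_map count_filter.
rewrite (eq_count (a2 := sq_bits (a :: s))) => [->//|t]; first by lia.
by rewrite /= andbC.
Qed.

Lemma natr_count (T : Type) (R : nzRingType) (p : pred T) (r : seq T) :
  \sum_(a <- r) (p a)%:R = (count p r)%:R :> R.
Proof.
by elim: r => [|a r IHr]; rewrite ?big_nil // big_cons IHr /= natrD.
Qed.

(** Write the hit as the degree d part of Sq f with f of degree below d; each monomial of f then
    contributes an even number of ones. *)
Lemma hits_kernel d S (x : Pdeg d) : (d < 32)%N ->
  all (fun a => (size a == 4) && (sumn a == d)) S -> kills_sq 4 d S ->
  x \in hits Pall d -> \sum_(a <- S) (val x)@_(mnm_of a) = 0.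
Proof.
move=> d32 /allP Sd kS /(hits_exists Pall_graded)[f [_ fd ->]].
rewrite (eq_big_seq (fun a =>
    \sum_(m <- msupp f) f@_m * (sq_bits (exps m) a)%:R)).
  rewrite exchange_big big1_seq //= => m mf.
  rewrite -mulr_sumr natr_count natr_F2 (negbTE (kills_sqP kS _ _)) ?mulr0 //.
    exact: size_exps.
  by rewrite sumn_exps (leq_trans (msize_mdeg_lt mf)).
move=> a /Sd /andP[/eqP a4 /eqP ad].
rewrite mcoeff_pihomog mdeg_of // ad eqxx [f in LHS]mpolyE.
rewrite [total_sq _]raddf_sum raddf_sum; apply: eq_bigr => m _ /=.
by rewrite [total_sq _]linearZ mcoeffZ mcoeff_total_sq_bits // ad.
Qed.

(** The monomial symmetric polynomial: [permutations] lists each rearrangement once, so repeated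
    exponents cause no cancellation. *)
Definition mono_sym (s : seq nat) : P4 :=
  \sum_(a <- permutations s) 'X_[mnm_of a].

Lemma mcoeff_mono_sym s m : size s = 4 ->
  (mono_sym s)@_m = (perm_eq (exps m) s)%:R.
Proof.
move=> s4; rewrite /mono_sym raddf_sum -mem_permutations.
rewrite (eq_big_seq (fun a => (a == exps m)%:R)) => [|a].
  by rewrite natr_count count_uniq_mem ?permutations_uniq.
rewrite mem_permutations => /perm_size; rewrite s4 => a4.
rewrite /= mcoeffX; congr (nat_of_bool _)%:R.
by apply/eqP/eqP => [<-|->]; rewrite ?exps_of ?mnm_of_exps.
Qed.

Lemma perm_exps (m : 'X_{1..4}) (s : 'S_4) :
  perm_eq (exps [multinom m (s i) | i < 4]) (exps m).
Proof.
rewrite /exps (eq_map (g := m \o s)) => [|i]; last by rewrite mnmE.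
rewrite map_comp perm_map // uniq_perm ?enum_uniq //.
  by rewrite map_inj_uniq ?enum_uniq //; apply: perm_inj.
move=> i; rewrite mem_enum; apply/mapP.
exists ((s^-1)%g i); rewrite ?mem_enum //.
by rewrite permKV.
Qed.

Lemma mono_sym_symmetric s : size s = 4 -> mono_sym s \is symmetric.
Proof.
move=> s4; apply/issymP => p; apply/mpolyP => m.
by rewrite mcoeff_sym !mcoeff_mono_sym // (permPl (perm_exps m p)).
Qed.

Lemma sym_mcoeff (f : P4) s t : f \is symmetric -> size s = 4 -> perm_eq s t ->
  f@_(mnm_of s) = f@_(mnm_of t).
Proof.
move=> /issymP fs s4 st; have t4 : size t = 4 by rewrite -(perm_size st).
have /tuple_permP[p sE] : perm_eq s (Tuple (introT eqP t4)) by [].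
rewrite -[in RHS](fs p) mcoeff_sym; congr (_@__); apply/mnmP => i.
rewrite !mnmE sE (nth_map ord0) ?size_enum_ord // nth_ord_enum.
by rewrite (tnth_nth 0%N).
Qed.

Definition sq_mono_bit (s t : seq nat) : bool :=
  odd (count (fun a => sq_bits a t) (permutations s)).

Lemma mcoeff_sq_mono s t : size s = 4 -> size t = 4 -> (sumn t < 32)%N ->
  (total_sq (mono_sym s))@_(mnm_of t) = (sq_mono_bit s t)%:R.
Proof.
move=> s4 t4 t32; rewrite [total_sq _]raddf_sum raddf_sum -natr_F2 -natr_count.
apply: eq_big_seq => a /=; rewrite mem_permutations => /perm_size.
rewrite s4 => a4.
by rewrite mcoeff_total_sq_bits // exps_of.
Qed.

Lemma hits_sq_mono d s : size s = 4 -> (sumn s < d)%N ->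
  homog_part d (total_sq (mono_sym s)) \in hits Bsym d.
Proof.
move=> s4 sd; have := hits_total_sq d Bsym_graded (mono_sym_symmetric s4).
suff s0 : homog_part d (mono_sym s) = 0 by rewrite raddfB /= s0 subr0.
apply/val_inj/mpolyP => m.
rewrite val_homog_part mcoeff_pihomog mcoeff_mono_sym //.
rewrite mcoeff0; case: eqP => // md.
case: (boolP (perm_eq _ _)) => // /perm_sumn.
by rewrite sumn_exps md => dE; rewrite -dE ltnn in sd.
Qed.

(* Each entry (t, s) of L records that the hit polynomial Sq(mono_sym s) has
   coefficient 1 at t and 0 at all earlier pivots, collected in Z. *)
Fixpoint echelon (d : nat) (Z : seq (seq nat)) (L : seq (seq nat * seq nat)) :=
  if L is (t, s) :: L' then
    [&& size s == 4, sumn s < d, size t == 4, sumn t == d, sq_mono_bit s t,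
        all (fun z => ~~ sq_mono_bit s z) Z & echelon d (t :: Z) L']%N
  else true.

Lemma echelon_reduce d Z L (x : Pdeg d) : (d < 32)%N ->
  all (fun z => (size z == 4) && (sumn z == d)) Z -> echelon d Z L ->
  {in Z, forall z, (val x)@_(mnm_of z) = 0} ->
  exists2 y, y \in hits Bsym d & {in catrev (unzip1 L) Z, forall z,
    (val (x - y))@_(mnm_of z) = 0}.
Proof.
move=> d32; elim: L Z x => [|[t s] L IHL] Z x Zd /=.
  by move=> _ xZ; exists 0; rewrite ?mem0v ?subr0.
case/and5P => /eqP s4 sd /eqP t4 /eqP td /and3P[st /allP sZ eL] xZ.
pose h := homog_part d (total_sq (mono_sym s)).
have hB : h \in hits Bsym d by apply: hits_sq_mono.
have hE z : size z = 4 -> sumn z = d ->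
    (val h)@_(mnm_of z) = (sq_mono_bit s z)%:R.
  move=> z4 zd; rewrite val_homog_part mcoeff_pihomog mdeg_of // zd eqxx.
  by rewrite mcoeff_sq_mono // zd.
(* Subtracting [c *: h] clears the coefficient at [t], where [h] is 1, and keeps the earlier zeros,
   where [h] vanishes. *)
pose c := (val x)@_(mnm_of t).
have xchZ : {in t :: Z, forall z, (val (x - c *: h))@_(mnm_of z) = 0}.
  have coefE z : (val (x - c *: h))@_(mnm_of z) =
      (val x)@_(mnm_of z) - c * (val h)@_(mnm_of z).
    by rewrite [val _](raddfB (@mpoly_of_dhomog 4 'F_2 d)) mcoeffB -mcoeffZ.
  move=> z; rewrite inE coefE => /predU1P[->|zZ].
    by rewrite hE // st mulr1 subrr.
  have /andP[/eqP z4 /eqP zd] := allP Zd _ zZ.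
  by rewrite xZ // hE // (negbTE (sZ _ zZ)) mulr0 subrr.
have [|y yB yZ] := IHL (t :: Z) (x - c *: h) _ eL xchZ.
  by rewrite /= t4 td !eqxx.
exists (c *: h + y); first by rewrite memvD ?memvZ.
by rewrite opprD addrA.
Qed.

(* Each entry (t, A) of T gives a functional, the sum of the coefficients at A,
   which kills all hits and involves, up to the values already known to vanish
   (collected in Z), only the coefficient at the partition t. *)
Fixpoint functional_cover (d : nat) (Z : seq (seq nat))
    (T : seq (seq nat * seq (seq nat))) : bool :=
  if T is (t, A) :: T' then
    [&& all (fun a => (size a == 4) && (sumn a == d)) A, kills_sq 4 d A,
        odd (count (fun a => sort geq a == t) A),
        all (fun a => (sort geq a == t) || (sort geq a \in Z)) A
      & functional_cover d (t :: Z) T']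
  else true.

(** By symmetry the coefficient at [a] is the one at the sorted [a]. Known zeros drop out of the
    functional, leaving an odd multiple of the coefficient at [t]. *)
Lemma functional_coverP d Z T (x : Pdeg d) : (d < 32)%N ->
  functional_cover d Z T -> x \in hits Pall d -> val x \is symmetric ->
  {in Z, forall z, (val x)@_(mnm_of z) = 0} ->
  {in catrev (unzip1 T) Z, forall z, (val x)@_(mnm_of z) = 0}.
Proof.
move=> d32 + xH xs; elim: T Z => [|[t A] T IHT] Z //=.
case/and5P => Ad kA tA /allP AZ coverT xZ; apply: IHT coverT _ => z.
rewrite inE => /predU1P[->{z}|/xZ //].
have := hits_kernel d32 Ad kA xH.
rewrite (eq_big_seq (fun a => (sort geq a == t)%:R * (val x)@_(mnm_of t))).
  by rewrite -mulr_suml natr_count natr_F2 tA mul1r.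
move=> a aA; have /andP[/eqP a4 _] := allP Ad _ aA.
have -> : (val x)@_(mnm_of a) = (val x)@_(mnm_of (sort geq a)).
  by apply: sym_mcoeff; rewrite // perm_sym perm_sort.
have /orP[/eqP->|aZ] := AZ _ aA; first by rewrite eqxx mul1r.
by case: eqP => [<-|_]; rewrite ?mul1r // mul0r xZ.
Qed.

(** The degree determines the fourth part; the bound on a + b + c keeps the truncated subtraction
    exact. *)
Definition partitions_in (d : nat) (Z : seq (seq nat)) : bool :=
  all (fun a => all (fun b => all (fun c =>
    (a + b + c <= d)%N && (d - (a + b + c) <= c)%N ==>
    ([:: a; b; c; d - (a + b + c)]%N \in Z))
  (iota 0 b.+1)) (iota 0 a.+1)) (iota 0 d.+1).

Lemma partitions_inP d Z s : partitions_in d Z -> size s = 4 -> sumn s = d ->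
  sorted geq s -> s \in Z.
Proof.
case: s => [|a [|b [|c [|e []]]]] //= dZ _ sd /and4P[ba cb ec _].
have /allP/(_ a) := dZ; rewrite mem_iota => /(_ _)/allP/(_ b).
rewrite mem_iota => /(_ _ _)/allP/(_ c); rewrite mem_iota => /(_ _ _ _)/implyP.
rewrite (_ : d - (a + b + c) = e)%N; last by lia.
by apply; rewrite /geq /= in ba cb ec *; lia.
Qed.

(* Both tables come from Gaussian elimination over F_2; the order of the entries
   is what makes the systems triangular. *)
Definition hit_pivots : seq (seq nat * seq nat) :=
  [:: ([:: 7; 7; 5; 3], [:: 7; 7; 3; 3]); ([:: 9; 7; 3; 3], [:: 7; 5; 3; 3]);
   ([:: 11; 5; 5; 1], [:: 7; 5; 5; 1]); ([:: 9; 6; 6; 1], [:: 7; 6; 6; 1]);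
   ([:: 14; 6; 1; 1], [:: 14; 5; 1; 1]); ([:: 14; 3; 3; 2], [:: 7; 3; 3; 2]);
   ([:: 11; 5; 3; 3], [:: 7; 3; 3; 3]); ([:: 13; 5; 3; 1], [:: 7; 5; 3; 1]);
   ([:: 11; 7; 3; 1], [:: 7; 7; 3; 1]); ([:: 14; 4; 3; 1], [:: 7; 4; 3; 1]);
   ([:: 14; 5; 2; 1], [:: 7; 5; 2; 1]); ([:: 11; 6; 3; 2], [:: 7; 6; 3; 2]);
   ([:: 14; 7; 1; 0], [:: 7; 7; 1; 0]); ([:: 13; 5; 2; 2], [:: 7; 5; 2; 2]);
   ([:: 13; 6; 2; 1], [:: 7; 6; 2; 1]); ([:: 12; 7; 3; 0], [:: 7; 6; 3; 0]);
   ([:: 13; 7; 2; 0], [:: 7; 7; 2; 0]); ([:: 7; 7; 6; 2], [:: 7; 7; 3; 2]);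
   ([:: 15; 6; 1; 0], [:: 15; 3; 1; 0]); ([:: 9; 7; 5; 1], [:: 9; 7; 3; 1]);
   ([:: 13; 4; 3; 2], [:: 7; 4; 3; 2]); ([:: 7; 7; 4; 4], [:: 7; 7; 2; 2]);
   ([:: 10; 6; 5; 1], [:: 9; 6; 3; 1]); ([:: 7; 5; 5; 5], [:: 7; 5; 5; 3]);
   ([:: 11; 7; 2; 2], [:: 11; 7; 1; 1]); ([:: 15; 3; 2; 2], [:: 15; 3; 1; 1]);
   ([:: 11; 4; 4; 3], [:: 7; 4; 4; 3]); ([:: 11; 6; 4; 1], [:: 7; 6; 4; 1]);
   ([:: 8; 7; 6; 1], [:: 8; 7; 3; 1]); ([:: 11; 11; 0; 0], [:: 7; 7; 0; 0]);
   ([:: 11; 5; 4; 2], [:: 7; 5; 4; 2]); ([:: 11; 6; 5; 0], [:: 7; 6; 5; 0]);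
   ([:: 11; 7; 4; 0], [:: 7; 7; 4; 0]); ([:: 10; 7; 5; 0], [:: 9; 7; 3; 0]);
   ([:: 12; 6; 3; 1], [:: 12; 3; 3; 1]); ([:: 13; 6; 3; 0], [:: 13; 3; 3; 0]);
   ([:: 10; 6; 3; 3], [:: 9; 5; 3; 3]); ([:: 15; 5; 2; 0], [:: 15; 3; 2; 0]);
   ([:: 10; 10; 1; 1], [:: 5; 5; 1; 1]); ([:: 9; 9; 2; 2], [:: 5; 5; 2; 2]);
   ([:: 10; 5; 5; 2], [:: 6; 5; 5; 1]); ([:: 11; 8; 3; 0], [:: 11; 4; 3; 0]);
   ([:: 9; 6; 4; 3], [:: 7; 6; 4; 3]); ([:: 9; 6; 5; 2], [:: 7; 6; 5; 2]);
   ([:: 9; 7; 6; 0], [:: 7; 7; 6; 0]); ([:: 8; 7; 5; 2], [:: 8; 7; 3; 2]);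
   ([:: 10; 5; 4; 3], [:: 10; 5; 3; 2]); ([:: 12; 5; 3; 2], [:: 12; 3; 3; 2]);
   ([:: 14; 5; 3; 0], [:: 14; 3; 3; 0]); ([:: 10; 7; 3; 2], [:: 9; 7; 3; 2]);
   ([:: 10; 7; 4; 1], [:: 9; 7; 4; 1]); ([:: 11; 10; 1; 0], [:: 11; 9; 1; 0]);
   ([:: 8; 8; 3; 3], [:: 4; 4; 3; 3]); ([:: 9; 9; 3; 1], [:: 5; 5; 3; 1]);
   ([:: 9; 5; 5; 3], [:: 5; 5; 5; 3]); ([:: 11; 9; 1; 1], [:: 9; 7; 1; 1]);
   ([:: 11; 9; 2; 0], [:: 9; 7; 2; 0]); ([:: 10; 9; 3; 0], [:: 10; 5; 3; 0]);
   ([:: 8; 8; 5; 1], [:: 8; 8; 3; 1]); ([:: 9; 5; 4; 4], [:: 9; 4; 4; 3]);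
   ([:: 9; 7; 4; 2], [:: 9; 7; 2; 2]); ([:: 9; 9; 4; 0], [:: 9; 9; 2; 0]);
   ([:: 12; 5; 5; 0], [:: 10; 5; 5; 0]); ([:: 13; 4; 4; 1], [:: 11; 4; 4; 1]);
   ([:: 13; 8; 1; 0], [:: 13; 6; 1; 0]); ([:: 13; 9; 0; 0], [:: 13; 7; 0; 0]);
   ([:: 7; 6; 5; 4], [:: 7; 6; 5; 3]); ([:: 8; 6; 5; 3], [:: 8; 5; 5; 3]);
   ([:: 12; 7; 2; 1], [:: 11; 7; 2; 1]); ([:: 12; 8; 1; 1], [:: 11; 8; 1; 1]);
   ([:: 15; 4; 3; 0], [:: 15; 3; 3; 0]); ([:: 15; 4; 2; 1], [:: 15; 4; 1; 1]);
   ([:: 16; 3; 2; 1], [:: 8; 3; 2; 1]); ([:: 16; 3; 3; 0], [:: 8; 3; 3; 0]);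
   ([:: 16; 4; 1; 1], [:: 8; 4; 1; 1]); ([:: 16; 5; 1; 0], [:: 8; 5; 1; 0]);
   ([:: 17; 2; 2; 1], [:: 9; 2; 2; 1]); ([:: 17; 3; 1; 1], [:: 9; 3; 1; 1]);
   ([:: 17; 3; 2; 0], [:: 9; 3; 2; 0]); ([:: 17; 5; 0; 0], [:: 9; 5; 0; 0]);
   ([:: 18; 3; 1; 0], [:: 10; 3; 1; 0]); ([:: 19; 1; 1; 1], [:: 11; 1; 1; 1]);
   ([:: 19; 2; 1; 0], [:: 11; 2; 1; 0]); ([:: 19; 3; 0; 0], [:: 11; 3; 0; 0]);
   ([:: 20; 1; 1; 0], [:: 12; 1; 1; 0]); ([:: 21; 1; 0; 0], [:: 13; 1; 0; 0]);
   ([:: 8; 5; 5; 4], [:: 8; 4; 3; 3]); ([:: 9; 8; 3; 2], [:: 8; 5; 3; 2]);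
   ([:: 10; 8; 3; 1], [:: 8; 6; 3; 1]); ([:: 11; 8; 2; 1], [:: 11; 4; 2; 1]);
   ([:: 6; 6; 5; 5], [:: 5; 5; 5; 5]); ([:: 9; 8; 5; 0], [:: 9; 6; 5; 0]);
   ([:: 9; 8; 4; 1], [:: 9; 8; 2; 1]); ([:: 12; 9; 1; 0], [:: 10; 9; 1; 0]);
   ([:: 12; 5; 4; 1], [:: 12; 5; 2; 1]); ([:: 13; 5; 4; 0], [:: 13; 4; 3; 0]);
   ([:: 17; 4; 1; 0], [:: 17; 2; 1; 0]); ([:: 6; 6; 6; 4], [:: 6; 6; 6; 3]);
   ([:: 8; 7; 7; 0], [:: 7; 7; 7; 0]); ([:: 8; 6; 4; 4], [:: 8; 5; 4; 4]);
   ([:: 8; 6; 6; 2], [:: 8; 6; 6; 1]); ([:: 8; 7; 4; 3], [:: 8; 7; 3; 3]);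
   ([:: 8; 8; 4; 2], [:: 8; 8; 4; 1]); ([:: 8; 8; 6; 0], [:: 8; 8; 5; 0]);
   ([:: 10; 6; 6; 0], [:: 9; 6; 6; 0]); ([:: 10; 4; 4; 4], [:: 10; 4; 4; 3]);
   ([:: 10; 6; 4; 2], [:: 10; 6; 4; 1]); ([:: 10; 8; 2; 2], [:: 10; 7; 2; 2]);
   ([:: 10; 8; 4; 0], [:: 10; 8; 3; 0]); ([:: 10; 9; 2; 1], [:: 10; 9; 1; 1]);
   ([:: 10; 10; 2; 0], [:: 10; 10; 1; 0]);
   ([:: 12; 4; 3; 3], [:: 12; 3; 3; 3]); ([:: 12; 4; 4; 2], [:: 12; 4; 4; 1]);
   ([:: 12; 6; 2; 2], [:: 12; 5; 2; 2]); ([:: 12; 6; 4; 0], [:: 12; 6; 3; 0]);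
   ([:: 12; 8; 2; 0], [:: 12; 8; 1; 0]); ([:: 12; 10; 0; 0], [:: 12; 9; 0; 0]);
   ([:: 14; 4; 4; 0], [:: 13; 4; 4; 0]); ([:: 14; 4; 2; 2], [:: 14; 3; 2; 2]);
   ([:: 14; 6; 2; 0], [:: 14; 6; 1; 0]); ([:: 14; 8; 0; 0], [:: 14; 7; 0; 0]);
   ([:: 16; 2; 2; 2], [:: 16; 2; 2; 1]); ([:: 16; 4; 2; 0], [:: 16; 4; 1; 0]);
   ([:: 16; 6; 0; 0], [:: 16; 5; 0; 0]); ([:: 18; 2; 2; 0], [:: 17; 2; 2; 0]);
   ([:: 18; 2; 1; 1], [:: 18; 1; 1; 1]); ([:: 18; 4; 0; 0], [:: 18; 3; 0; 0]);
   ([:: 20; 2; 0; 0], [:: 20; 1; 0; 0]);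
   ([:: 22; 0; 0; 0], [:: 21; 0; 0; 0])]%N.

Definition kernel_functionals : seq (seq nat * seq (seq nat)) :=
  [:: ([:: 15; 7; 0; 0],
    [:: [:: 0; 0; 15; 7]]);
   ([:: 15; 3; 3; 1],
    [:: [:: 1; 3; 3; 15]]);
   ([:: 7; 7; 7; 1],
    [:: [:: 1; 7; 7; 7]]);
   ([:: 13; 3; 3; 3],
    [:: [:: 7; 3; 3; 9]; [:: 7; 5; 3; 7]; [:: 11; 3; 3; 5]; [:: 13; 3; 3; 3]]);
   ([:: 15; 5; 1; 1],
    [:: [:: 1; 1; 5; 15]; [:: 1; 2; 4; 15]; [:: 1; 4; 2; 15]; [:: 1; 5; 1; 15];
     [:: 2; 1; 4; 15]; [:: 2; 2; 3; 15]; [:: 2; 3; 2; 15]; [:: 2; 4; 1; 15];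
     [:: 3; 2; 2; 15]; [:: 4; 1; 2; 15]; [:: 4; 2; 1; 15]; [:: 5; 1; 1; 15]]);
   ([:: 7; 6; 6; 3],
    [:: [:: 1; 3; 5; 13]; [:: 1; 3; 6; 12]; [:: 1; 3; 12; 6]; [:: 1; 3; 13; 5];
     [:: 1; 5; 3; 13]; [:: 1; 5; 6; 10]; [:: 1; 5; 10; 6]; [:: 1; 5; 13; 3];
     [:: 1; 6; 3; 12]; [:: 1; 6; 5; 10]; [:: 1; 6; 10; 5]; [:: 1; 6; 12; 3];
     [:: 1; 10; 5; 6]; [:: 1; 10; 6; 5]; [:: 1; 12; 3; 6]; [:: 1; 12; 6; 3];
     [:: 1; 13; 3; 5]; [:: 1; 13; 5; 3]; [:: 2; 3; 5; 12]; [:: 2; 3; 6; 11];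
     [:: 2; 3; 11; 6]; [:: 2; 3; 12; 5]; [:: 2; 5; 3; 12]; [:: 2; 5; 6; 9];
     [:: 2; 5; 9; 6]; [:: 2; 5; 12; 3]; [:: 2; 6; 3; 11]; [:: 2; 6; 5; 9];
     [:: 2; 6; 9; 5]; [:: 2; 6; 11; 3]; [:: 2; 9; 5; 6]; [:: 2; 9; 6; 5];
     [:: 2; 11; 3; 6]; [:: 2; 11; 6; 3]; [:: 2; 12; 3; 5]; [:: 2; 12; 5; 3];
     [:: 3; 3; 6; 10]; [:: 3; 3; 10; 6]; [:: 3; 6; 3; 10]; [:: 3; 6; 6; 7];
     [:: 3; 6; 7; 6]; [:: 3; 6; 10; 3]; [:: 3; 7; 6; 6]; [:: 3; 10; 3; 6];
     [:: 3; 10; 6; 3]; [:: 3; 13; 3; 3]; [:: 4; 3; 5; 10]; [:: 4; 3; 6; 9];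
     [:: 4; 3; 9; 6]; [:: 4; 3; 10; 5]; [:: 4; 5; 3; 10]; [:: 4; 5; 6; 7];
     [:: 4; 5; 7; 6]; [:: 4; 5; 10; 3]; [:: 4; 6; 3; 9]; [:: 4; 6; 5; 7];
     [:: 4; 6; 7; 5]; [:: 4; 6; 9; 3]; [:: 4; 7; 5; 6]; [:: 4; 7; 6; 5];
     [:: 4; 9; 3; 6]; [:: 4; 9; 6; 3]; [:: 4; 10; 3; 5]; [:: 4; 10; 5; 3];
     [:: 5; 3; 5; 9]; [:: 5; 3; 9; 5]; [:: 5; 5; 3; 9]; [:: 5; 5; 5; 7];
     [:: 5; 5; 7; 5]; [:: 5; 5; 9; 3]; [:: 5; 7; 5; 5]; [:: 5; 9; 3; 5];
     [:: 5; 9; 5; 3]; [:: 5; 11; 3; 3]; [:: 7; 5; 3; 7]; [:: 7; 5; 7; 3];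
     [:: 9; 3; 3; 7]; [:: 9; 3; 7; 3]]);
   ([:: 13; 7; 1; 1],
    [:: [:: 1; 1; 13; 7]; [:: 1; 2; 12; 7]; [:: 1; 3; 11; 7]; [:: 1; 4; 10; 7];
     [:: 1; 5; 9; 7]; [:: 1; 6; 8; 7]; [:: 1; 8; 6; 7]; [:: 1; 9; 5; 7];
     [:: 1; 10; 4; 7]; [:: 1; 11; 3; 7]; [:: 1; 12; 2; 7]; [:: 1; 13; 1; 7];
     [:: 2; 1; 12; 7]; [:: 2; 2; 11; 7]; [:: 2; 3; 10; 7]; [:: 2; 4; 9; 7];
     [:: 2; 5; 8; 7]; [:: 2; 6; 7; 7]; [:: 2; 7; 6; 7]; [:: 2; 8; 5; 7];
     [:: 2; 9; 4; 7]; [:: 2; 10; 3; 7]; [:: 2; 11; 2; 7]; [:: 2; 12; 1; 7];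
     [:: 3; 1; 7; 11]; [:: 3; 2; 10; 7]; [:: 3; 3; 9; 7]; [:: 3; 4; 8; 7];
     [:: 3; 6; 6; 7]; [:: 3; 8; 4; 7]; [:: 3; 9; 3; 7]; [:: 3; 10; 2; 7];
     [:: 3; 11; 1; 7]; [:: 4; 1; 10; 7]; [:: 4; 2; 9; 7]; [:: 4; 3; 8; 7];
     [:: 4; 4; 7; 7]; [:: 4; 5; 6; 7]; [:: 4; 6; 5; 7]; [:: 4; 7; 4; 7];
     [:: 4; 8; 3; 7]; [:: 4; 9; 2; 7]; [:: 4; 10; 1; 7]; [:: 5; 1; 9; 7];
     [:: 5; 2; 8; 7]; [:: 5; 4; 6; 7]; [:: 5; 5; 5; 7]; [:: 5; 6; 4; 7];
     [:: 5; 8; 2; 7]; [:: 5; 9; 1; 7]; [:: 6; 1; 8; 7]; [:: 6; 2; 7; 7];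
     [:: 6; 3; 6; 7]; [:: 6; 4; 5; 7]; [:: 6; 5; 4; 7]; [:: 6; 6; 3; 7];
     [:: 6; 7; 2; 7]; [:: 6; 8; 1; 7]; [:: 7; 2; 6; 7]; [:: 7; 4; 4; 7];
     [:: 7; 6; 2; 7]; [:: 8; 1; 6; 7]; [:: 8; 2; 5; 7]; [:: 8; 3; 4; 7];
     [:: 8; 4; 3; 7]; [:: 8; 5; 2; 7]; [:: 8; 6; 1; 7]; [:: 9; 1; 5; 7];
     [:: 9; 2; 4; 7]; [:: 9; 3; 3; 7]; [:: 9; 4; 2; 7]; [:: 9; 5; 1; 7];
     [:: 10; 1; 4; 7]; [:: 10; 2; 3; 7]; [:: 10; 3; 2; 7]; [:: 10; 4; 1; 7];
     [:: 11; 1; 3; 7]; [:: 11; 2; 2; 7]; [:: 11; 3; 1; 7]; [:: 12; 1; 2; 7];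
     [:: 12; 2; 1; 7]; [:: 13; 1; 1; 7]])]%N.

Lemma hit_pivots_echelon : echelon 22 [::] hit_pivots.
Proof. by vm_compute. Qed.

Lemma kernel_functionals_cover :
  functional_cover 22 (catrev (unzip1 hit_pivots) [::]) kernel_functionals.
Proof. by vm_compute. Qed.

Lemma pivots_partitions : partitions_in 22
  (catrev (unzip1 kernel_functionals) (catrev (unzip1 hit_pivots) [::])).
Proof. by vm_compute. Qed.

(** Subtracting a symmetric hit makes [x] vanish at all pivots. The rest is still hit in P(4), so
    the functionals kill its remaining coefficients at partitions, and these determine a symmetric
    polynomial. *)
Lemma hits22 : (Bsym 22 :&: hits Pall 22 <= hits Bsym 22)%VS.
Proof.
apply/subvP => x; rewrite memv_cap => /andP[xB xP].
have [//|//|//|y yB yZ] := echelon_reduce (x := x) _ _ hit_pivots_echelon.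
suff xy0 : x - y = 0 by rewrite (subr0_eq xy0).
have xyP : x - y \in hits Pall 22 by rewrite memvB // (subvP (hits_mono 22)).
have xys : val (x - y) \is symmetric.
  by rewrite -mem_Bsym memvB // (subvP (hits_Bsym 22)).
have xyZ := functional_coverP _ kernel_functionals_cover xyP xys yZ.
apply/val_inj/mpolyP => m; rewrite [RHS]mcoeff0.
have [m22|m22] := eqVneq (mdeg m) 22; last first.
  exact: (dhomog_nemf_coeff (dhomog_is_dhomog (x - y)) m22).
have -> : (val (x - y))@_m = (val (x - y))@_(mnm_of (sort geq (exps m))).
  rewrite -[m in LHS]mnm_of_exps.
  by apply: sym_mcoeff; rewrite ?size_exps // perm_sym perm_sort.
apply: xyZ => //; apply: (partitions_inP pivots_partitions).
- by rewrite size_sort size_exps.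
- by rewrite (perm_sumn (permEl (perm_sort _ _))) sumn_exps.
- by apply: sort_sorted => a b; apply: leq_total.
Qed.

(** * From hits to relative cohits and Steenrod kernels *)

Lemma hits_sub (M : forall d, {vspace Pdeg d}) d (x : Pdeg d)
    (K : {vspace Pdeg d}) :
  (forall r, (0 < r <= d)%N -> (Sq d r @: M (d - r)%N <= K)%VS) ->
  x \in hits M d -> x \in K.
Proof.
move=> MK; apply: subvP; rewrite /hits big_nat.
elim/big_ind: _ => [|U V UK VK|r rd]; first exact: sub0v.
  by rewrite subv_add UK.
exact: MK.
Qed.

(** By hypothesis [Theta] vanishes on the intersection of B with [H]. With [C] a complement of that
    intersection in B, projecting onto [C] along [H] before applying [Theta] gives an extension that
    kills [H]. *)
Lemma rho_surjective d : (Bsym d :&: hits Pall d <= hits Bsym d)%VS ->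
  forall Theta : 'Hom(subvs_of (Bsym d), ('F_2)^o), sym_steenrod_kernel Theta ->
  exists2 Psi : 'Hom(Pdeg d, ('F_2)^o), steenrod_kernel Psi & rho Psi = Theta.
Proof.
move=> BP Theta ThetaK; pose H := hits Pall d; pose C := (Bsym d :\: H)%VS.
have CH : (C :&: H = 0)%VS by apply: capv_diff.
(* [vsproj] is a linear retraction onto B, so [Th] extends [Theta] to the whole degree d space. *)
pose Th := linfun (Theta \o vsproj (Bsym d)).
have ThB b : b \in hits Bsym d -> Th b = 0.
  move=> bB; apply/eqP; rewrite -memv_ker; apply: hits_sub bB => r rd.
  apply/subvP => _ /memv_imgP[f fB ->]; rewrite memv_ker lfunE /=.
  have -> : vsproj (Bsym d) (Sq d r f) = Sq_B (Subvs fB).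
    by apply: subvs_inj; apply: vsprojK (Sq_sym fB).
  by rewrite ThetaK.
have piH h : h \in H -> daddv_pi C H h = 0.
  move=> hH; have := daddv_pi_add CH (subvP (addvSr C H) _ hH).
  rewrite (daddv_pi_id _ hH) 1?capvC //.
  by move/(congr1 (fun z => z - h)); rewrite addrK subrr.
exists (Th \o daddv_pi C H)%VF.
  move=> r rd f; rewrite comp_lfunE piH ?linear0 //.
  have /subvP : (Sq d r @: Pall (d - r)%N <= H)%VS.
    rewrite /H /hits (bigD1_seq r) ?iota_uniq ?mem_index_iota ?addvSl //=.
  by apply; rewrite memv_img // memvf.
apply/lfunP => b; rewrite rhoE comp_lfunE.
(* Split [b] along B = C + (B ∩ H); on the second summand [Th] vanishes by [BP]. *)
have : vsval b \in (C + (Bsym d :&: H))%VS by rewrite addv_diff_cap subvsP.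
case/memv_addP => c cC [h hBH bE].
have /andP[hB hH] : (h \in Bsym d) && (h \in H) by rewrite -memv_cap.
have -> : daddv_pi C H (vsval b) = vsval b - h.
  by rewrite [in LHS]bE linearD /= (piH h hH) addr0 daddv_pi_id // bE addrK.
have Thh : Th h = 0 by rewrite ThB ?(subvP BP).
rewrite linearB /= Thh subr0 lfunE; congr (Theta _).
by apply: subvs_inj; apply: vsprojK (subvsP b).
Qed.

Lemma relative_cohits0 d : (Bsym d :&: hits Pall d <= hits Bsym d)%VS ->
  relative_cohits d =i pred1 0.
Proof.
move=> BP x; rewrite -[x]cohit_reprK mem_relative_cohits !inE.
rewrite -(raddf0 (@cohit_class Bsym d)) cohit_class_eq /= subr0.
apply/idP/idP => [xP|]; last exact: (subvP (hits_mono d)).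
by rewrite (subvP BP) // memv_cap subvsP.
Qed.

Theorem corollary1p5 (t : nat) :
  relative_cohits (26 * 2 ^ t - 4) =i pred1 0%R
  /\ (forall Theta : 'Hom(subvs_of (Bsym (26 * 2 ^ t - 4)), ('F_2)^o),
        sym_steenrod_kernel Theta ->
        exists2 Psi : 'Hom(Pdeg (26 * 2 ^ t - 4), ('F_2)^o),
          steenrod_kernel Psi & rho Psi = Theta).
Proof.
have BP := hits_kameko_iter t hits22.
by split; [apply: relative_cohits0 | apply: rho_surjective].
Qed.
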